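(* Let $(\mathcal M,[\,,\,],\langle\,,\,\rangle)$ be a flat Lorentzian Malcev algebra such that its center $Z(\mathcal M)$ is degenerate. Then $(\mathcal M,[\,,\,],\langle\,,\,\rangle)$ is a flat double extension of a flat Euclidean Malcev algebra $(\overline{\mathcal M},[\,,\,]_{\overline{\mathcal M}},\langle\,,\,\rangle_{\overline{\mathcal M}})$ by means of $(D,\xi,b_0,0)$, for some linear maps $D,\xi:\overline{\mathcal M}\to\overline{\mathcal M}$ and some $b_0\in\overline{\mathcal M}$.
   Context: All vector spaces are finite dimensional; here the base field is $\mathbb K=\mathbb R$. A Malcev algebra is a vector space with an anti-symmetric bilinear bracket satisfying $J(u,v,[u,w])=[J(u,v,w),u]$, where $J(u,v,w)=[[u,v],w]+[[w,u],v]+[[v,w],u]$. A pseudo-Euclidean Malcev algebra is a Malcev algebra with a non-degenerate symmetric bilinear form; it is Euclidean if the form is positive definite (the zero space being allowed), Lorentzian if the form has signature $(1,n-1)$ (one minus sign). The Levi-Civita product $\bullet$ is defined by $2\langle u\bullet v,w\rangle=\langle[u,v],w\rangle-\langle[v,w],u\rangle+\langle[w,u],v\rangle$; $\mathrm L_u(v)=u\bullet v$. The algebra is flat if $K=0$, where $$K(u,v,w)=\mathrm L_{[[u,v],w]}-\mathrm L_{[u,w]}\circ\mathrm L_v-\mathrm L_u\circ\mathrm L_{[v,w]}+\mathrm L_v\circ\mathrm L_u\circ\mathrm L_w-\mathrm L_w\circ\mathrm L_v\circ\mathrm L_u.$$ The center is $Z(\mathcal M)=\{u:[u,v]=0\ \forall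 v\in\mathcal M\}$; it is degenerate if $Z(\mathcal M)\cap Z(\mathcal M)^\perp\neq\{0\}$. Flat double extension: let $(\overline{\mathcal M},[\,,\,]_{\overline{\mathcal M}},\langle\,,\,\rangle_{\overline{\mathcal M}})$ be a flat pseudo-Euclidean Malcev algebra with Levi-Civita product $\bullet_{\overline{\mathcal M}}$, $D,\xi\in\mathrm{End}(\overline{\mathcal M})$, $b_0\in\overline{\mathcal M}$, $\lambda\in\mathbb K$. A flat pseudo-Euclidean Malcev algebra is a flat double extension of $\overline{\mathcal M}$ by means of $(D,\xi,b_0,\lambda)$ if it is isometrically isomorphic to $\mathbb Kd\oplus\overline{\mathcal M}\oplus\mathbb Ke$ with the bracket $$[d,e]=\lambda e,\quad [d,u]=D(u)+\langle b_0,u\rangle_{\overline{\mathcal M}}e,\quad [e,u]=0,\quad [u,v]=[u,v]_{\overline{\mathcal M}}-\langle(\xi-\xi^* )(u),v\rangle_{\overline{\mathcal M}}e,$$ the form extending $\langle\,,\,\rangle_{\overline{\mathcal M}}$ with $\langle e,d\rangle=1$, $\langle d,d\rangle=\langle e,e\rangle=0$, $\langle d,\overline{\mathcal M}\rangle=\langle e,\overline{\mathcal M}\rangle=0$, and whose Levi-Civita product is $e\bullet e=e\bullet u=u\bullet e=e\bullet d=0$, $d\bullet e=\lambda e$, $d\bullet u=(D+\xi)(u)+\langle b_0,u\rangle_{\overline{\mathcal M}}e$, $u\bullet d=\xi(u)$, $d\bullet d=-b_0-\lambda d$, $u\bullet v=u\bullet_{\overline{\mathcal M}}v-\langle\xi(u),v\rangle_{\overline{\mathcal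 M}}e$, for $u,v\in\overline{\mathcal M}$ ($\xi^*$ is the adjoint of $\xi$). *)

(* Defs.v *)
From HB Require Import structures.
From mathcomp Require Import all_boot all_order all_algebra.
From mathcomp Require Import ring.
From mathcomp Require Import boolp classical_sets reals.

Set Implicit Arguments.
Unset Strict Implicit.
Unset Printing Implicit Defensive.

Import Order.TTheory GRing.Theory Num.Theory.
Local Open Scope classical_set_scope.
Local Open Scope ring_scope.

Section Bracket.
Variables (R : realType) (V : vectType R) (br : V -> V -> V) (B : V -> V -> R).

Local Notation "[ u , v ]" := (br u v).

Definition jacobiator (u v w : V) : V :=
  [[u, v], w] + [[w, u], v] + [[v, w], u].

Definition center : set V := [set u | forall v, [u, v] = 0].

Definition orthogonal_set (S : set V) : set V :=
  [set u | forall v, S v -> B u v = 0].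

Definition is_levi_civita_value (u v x : V) : Prop :=
  forall w, 2 * B x w = B [u, v] w - B [v, w] u + B [w, u] v.

(* The value is unique when [B] is non-degenerate; see [levi_civitaP]. *)
Definition levi_civita (u v : V) : V := xget 0 (is_levi_civita_value u v).

Definition curvature (u v w x : V) : V :=
  let L := levi_civita in
  L [[u, v], w] x - L [u, w] (L v x) - L u (L [v, w] x)
    + L v (L u (L w x)) - L w (L v (L u x)).

Definition flat_bracket : Prop := forall u v w x, curvature u v w x = 0.

(* [p] minus signs followed by [q] plus signs *)
Definition has_signature (p q : nat) : Prop :=
  exists b : (p + q).-tuple V, basis_of fullv b /\
    forall i j : 'I_(p + q),
      B (tnth b i) (tnth b j) =
        if i == j then (if (i < p)%N then -1 else 1) else 0.

(* Unique when [B] is non-degenerate; see [adjointP]. *)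
Definition adjoint (f : 'End(V)) : 'End(V) :=
  xget 0 [set g : 'End(V) | forall u v, B (f u) v = B u (g v)].

End Bracket.

Record pseudoEuclideanMalcev (R : realType) := PseudoEuclideanMalcev {
  malcev_space :> vectType R;
  mbr : {bilinear malcev_space -> malcev_space -> malcev_space};
  mform : {symmetric malcev_space};
  mbr_antisym : forall u v, mbr u v = - mbr v u;
  mbr_malcev : forall u v w,
    jacobiator mbr u v (mbr u w) = mbr (jacobiator mbr u v w) u;
  mform_nondegenerate : nondegenerate mform
}.

Arguments mbr {R} p.
Arguments mform {R} p.

Section PseudoEuclideanMalcevTheory.
Variables (R : realType) (M : pseudoEuclideanMalcev R).

Definition flat : Prop := flat_bracket (mbr M) (mform M).

Definition euclidean : Prop := forall u : M, u != 0 -> 0 < mform M u u.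

Definition lorentzian : Prop := has_signature (mform M) 1 (\dim {:M}).-1.

Definition degenerate_center : Prop :=
  center (mbr M) `&` orthogonal_set (mform M) (center (mbr M)) <> [set 0].

End PseudoEuclideanMalcevTheory.

Section NondegenerateForm.
Variables (R : realType) (V : vectType R) (B : {symmetric V}).
Hypothesis ndB : nondegenerate B.

Lemma form_sym u v : B u v = B v u.
Proof. by rewrite (hermC B) /= expr0 mul1r. Qed.

Lemma nondegenerate_eq0 x : (forall w, B x w = 0) -> x = 0.
Proof.
move=> Bx; apply/eqP; rewrite -memv0 -(eqP ndB).
by apply/mem_orthovP => w _; apply: Bx.
Qed.

Lemma nondegenerate_inj x y : (forall w, B x w = B y w) -> x = y.
Proof.
move=> Bxy; apply/eqP; rewrite -subr_eq0; apply/eqP/nondegenerate_eq0 => w.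
by rewrite linearBl /= Bxy subrr.
Qed.

Lemma nondegenerate_represents (h : {linear V -> R^o}) :
  exists x : V, forall w, B x w = h w.
Proof.
pose n := \dim {:V}; pose e := vbasis {:V}.
pose p x : 'rV[R]_n := \row_i B x e`_i.
have p_lin : linear p.
  by move=> a x y; apply/rowP => i; rewrite !mxE linearPl.
pose pL := GRing.isLinear.Build R V 'rV[R]_n *:%R p p_lin.
pose P : {linear V -> 'rV[R]_n} := HB.pack p pL.
have kP : lker (linfun P) == 0%VS.
  apply/eqP/vspaceP => x; rewrite memv_ker lfunE /= memv0.
  apply/eqP/eqP => [/rowP px0|->]; last exact: (linear0 P).
  apply: nondegenerate_eq0 => w; rewrite (coord_vbasis (memvf w)) linear_sumr.
  rewrite big1 // => i _; rewrite linearZr /=.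
  by have := px0 i; rewrite !mxE => ->; rewrite mulr0.
have imP : limg (linfun P) = fullv.
  apply/eqP; rewrite eqEdim subvf /= limg_dim_eq; last first.
    by rewrite (eqP kP) capv0.
  by rewrite [in X in (X <= _)%N]dimvf /dim /= mul1n.
have /memv_imgP[x _ hx] : \row_i h e`_i \in limg (linfun P).
  by rewrite imP memvf.
exists x => w; rewrite [w in LHS](coord_vbasis (memvf w)).
rewrite [w in RHS](coord_vbasis (memvf w)) linear_sumr linear_sum.
apply: eq_bigr => i _; rewrite linearZr linearZ /=; congr (_ * _).
by move/rowP: hx => /(_ i); rewrite lfunE !mxE => ->.
Qed.

Lemma levi_civitaP (br : {bilinear V -> V -> V}) u v x :
  x = levi_civita br B u v <-> is_levi_civita_value br B u v x.
Proof.
have uniq y z : is_levi_civita_value br B u v y ->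
    is_levi_civita_value br B u v z -> y = z.
  move=> hy hz; apply: nondegenerate_inj => w.
  by apply: (@mulfI _ 2); rewrite ?pnatr_eq0 // hy hz.
have ex : exists y, is_levi_civita_value br B u v y.
  pose h w : R^o :=
    2^-1 * (B (br u v) w - B (br v w) u + B (br w u) v).
  have h_lin : linear h.
    move=> a y z; rewrite /h !linearPr !linearPl /=.
    by rewrite /GRing.scale /=; ring.
  have [y hy] := nondegenerate_represents
    (HB.pack h (GRing.isLinear.Build R V R^o *:%R h h_lin)).
  by exists y => w; rewrite hy /= /h mulrA divff ?pnatr_eq0 // mul1r.
split=> [->|hx]; first exact: xgetPex.
by apply: uniq => //; apply: xgetPex.
Qed.

Lemma adjointP (f g : 'End(V)) :
  g = adjoint B f <-> forall u v, B (f u) v = B u (g v).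
Proof.
have uniq (g1 g2 : 'End(V)) : (forall u v, B (f u) v = B u (g1 v)) ->
    (forall u v, B (f u) v = B u (g2 v)) -> g1 = g2.
  move=> h1 h2; apply/lfunP => v; apply: nondegenerate_inj => w.
  by rewrite ![B _ w]form_sym -h1 -h2.
have ex : exists g' : 'End(V), forall u v, B (f u) v = B u (g' v).
  have lin v : linear (fun u => B (f u) v : R^o).
    by move=> a y z; rewrite linearP linearPl.
  pose h v : {linear V -> R^o} := HB.pack (fun u => B (f u) v : R^o)
    (GRing.isLinear.Build R V R^o *:%R (fun u => B (f u) v) (lin v)).
  have [k hk] := choice (fun v => nondegenerate_represents (h v)).
  have hk' x w : B (k x) w = B (f w) x by exact: hk.
  have k_lin : linear k.
    move=> a y z; apply: nondegenerate_inj => w.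
    have Pl s t v : B (a *: s + t) v = a * B s v + B t v by exact: linearPl.
    by rewrite Pl !hk' ![B (f w) _]form_sym Pl.
  exists (linfun (HB.pack k (GRing.isLinear.Build R V V *:%R k k_lin)
    : {linear V -> V})) => u v.
  by rewrite lfunE /= [RHS]form_sym hk'.
split=> [->|hg]; first exact: (xgetPex _ ex).
by apply: uniq => //; apply: (xgetPex _ ex).
Qed.

End NondegenerateForm.

Section DoubleExtension.
Variables (R : realType) (N : pseudoEuclideanMalcev R).
Variables (D xi : 'End(N)) (b0 : N) (lam : R).

(* [(a, u, c)] stands for [a d + u + c e]. *)
Definition dext_space : vectType R := (R^o * N * R^o)%type.

Definition dext_d : dext_space := (1, 0, 0).
Definition dext_in (u : N) : dext_space := (0, u, 0).
Definition dext_e : dext_space := (0, 0, 1).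

(* The operations below are the bilinear extensions of the tables of their
   values on [d], [N] and [e]; the tables are recovered in the lemmas. *)
Definition dext_br (x y : dext_space) : dext_space :=
  let: (a, u, c) := x in let: (a', v, c') := y in
  (0,
   a *: D v - a' *: D u + mbr N u v,
   lam * (a * c' - a' * c) + a * mform N b0 v - a' * mform N b0 u
     - mform N ((xi - adjoint (mform N) xi) u) v).

Definition dext_form (x y : dext_space) : R :=
  let: (a, u, c) := x in let: (a', v, c') := y in
  a * c' + c * a' + mform N u v.

Definition dext_lc (x y : dext_space) : dext_space :=
  let: (a, u, c) := x in let: (a', v, c') := y in
  (- (lam * a * a'),
   - ((a * a') *: b0) + a *: (D + xi) v + a' *: xi u
     + levi_civita (mbr N) (mform N) u v,
   lam * a * c' + a * mform N b0 v - mform N (xi u) v).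

Lemma dext_eq (x y : dext_space) :
  x.1.1 = y.1.1 -> x.1.2 = y.1.2 -> x.2 = y.2 -> x = y.
Proof.
by case: x y => [[a u] c] [[a' u'] c'] /= -> -> ->.
Qed.

Let scaleRo (a b : R) : a *: (b : R^o) = a * b. Proof. by []. Qed.

Let simp := (scaleRo, scale0r, scale1r, linear0, linear0l, linear0r, mulr0,
  mul0r, mulr1, mul1r, addr0, add0r, subr0, oppr0).

Lemma dext_decomp (a c : R) (u : N) :
  (a, u, c) = a *: dext_d + dext_in u + c *: dext_e :> dext_space.
Proof.
by apply: dext_eq; rewrite /= ?scaler0 ?simp.
Qed.

Lemma dext_brE (u v : N) :
  [/\ dext_br dext_d dext_e = lam *: dext_e,
      dext_br dext_d (dext_in u) = dext_in (D u) + mform N b0 u *: dext_e,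
      dext_br dext_e (dext_in u) = 0
    & dext_br (dext_in u) (dext_in v) = dext_in (mbr N u v)
        - mform N ((xi - adjoint (mform N) xi) u) v *: dext_e].
Proof.
by split; apply: dext_eq; rewrite /= ?scaler0 ?simp.
Qed.

Lemma dext_br_antisym x y : dext_br x y = - dext_br y x.
Proof.
case: x y => [[a u] c] [[a' v] c']; apply: dext_eq => /=.
- by rewrite oppr0.
- by rewrite [mbr N u v]mbr_antisym !opprD !opprK [- _ + _]addrC.
- have adj := (adjointP (mform_nondegenerate N) xi _).1 erefl.
  rewrite !add_lfunE !opp_lfunE !linearBl /=.
  rewrite -[mform N (adjoint _ _ u) v]form_sym -adj.
  by rewrite [mform N (adjoint _ _ v) u]form_sym -adj; ring.
Qed.

Lemma dext_formE (u v : N) :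
  [/\ dext_form dext_e dext_d = 1, dext_form dext_d dext_d = 0,
      dext_form dext_e dext_e = 0, dext_form dext_d (dext_in u) = 0
    & dext_form dext_e (dext_in u) = 0
      /\ dext_form (dext_in u) (dext_in v) = mform N u v].
Proof. by split; rewrite /= ?simp. Qed.

Lemma dext_lcE (u v : N) :
  [/\ [/\ dext_lc dext_e dext_e = 0, dext_lc dext_e (dext_in u) = 0,
          dext_lc (dext_in u) dext_e = 0 & dext_lc dext_e dext_d = 0],
      dext_lc dext_d dext_e = lam *: dext_e
        /\ dext_lc dext_d (dext_in u)
             = dext_in ((D + xi) u) + mform N b0 u *: dext_e,
      dext_lc (dext_in u) dext_d = dext_in (xi u),
      dext_lc dext_d dext_d = - dext_in b0 - lam *: dext_d
    & dext_lc (dext_in u) (dext_in v)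
        = dext_in (levi_civita (mbr N) (mform N) u v)
          - mform N (xi u) v *: dext_e].
Proof.
have lc0 : (forall w, levi_civita (mbr N) (mform N) 0 w = 0) /\
           (forall w, levi_civita (mbr N) (mform N) w 0 = 0).
  by split=> w; apply/esym/(levi_civitaP (mform_nondegenerate N)) => z;
    rewrite !simp.
split; [split|split|..]; apply: dext_eq;
  by rewrite /= ?lc0.1 ?lc0.2 ?scaler0 ?simp.
Qed.

End DoubleExtension.

Definition flat_double_extension (R : realType)
    (M N : pseudoEuclideanMalcev R) (D xi : 'End(N)) (b0 : N) (lam : R) : Prop :=
  [/\ flat M, flat N,
      forall x y : dext_space N,
        levi_civita (dext_br D xi b0 lam) (@dext_form R N) x y
          = dext_lc D xi b0 lam x y
    & exists f : 'Hom(M, dext_space N),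
        [/\ bijective f,
            forall u v, f (mbr M u v) = dext_br D xi b0 lam (f u) (f v)
          & forall u v, dext_form (f u) (f v) = mform M u v]].

(* Main.v *)
Require Import Defs.
From HB Require Import structures.
From mathcomp Require Import all_boot all_order all_algebra.
From mathcomp Require Import boolp classical_sets reals.
From mathcomp Require Import ring lra.

Set Implicit Arguments.
Unset Strict Implicit.
Unset Printing Implicit Defensive.

Import Order.TTheory GRing.Theory Num.Theory.
Local Open Scope ring_scope.

(** A degenerate centre contains an isotropic vector [e <> 0], and the theorem
    amounts to reducing [M] along the null line of [e]: the underlying vector
    space of the Euclidean factor is the orthogonal [N] of a hyperbolic plane
    [<e, d>], which stands for the quotient [e^perp / <e>].

    Everything rests on [e . v = 0] for all [v] ([lc_central_eq0]), that is, on
    [L_e = 0].  As [e] is central, [L_e] is also the right multiplication by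
    [e], and the curvature identity with one or two arguments equal to [e]
    collapses to [L_e o L_v o L_e = 0] and [L_v o L_e^2 = 0].  Put [A = L_e], a
    skew map.  Then [A^2 x] is isotropic and orthogonal to [e], so in Lorentzian
    signature it is a multiple [c e]; if [c <> 0], then [L_v o A^2 = 0] says
    [v . e = 0] for all [v], that is, [A = 0].  So [A^2 = 0] in all cases, which
    makes [A x] isotropic as well, hence again a multiple of [e]; a skew map
    with values in the line of [e] vanishes off [e^perp], and therefore
    everywhere.

    From [L_e = 0] follows [<[u, v], e> = 0] ([form_br_central]).  Thus [e^perp]
    is closed under the bracket and under the Levi-Civita product, the line of
    [e] is an ideal of it for both products, and the projection of [e^perp] onto
    [N] is a homomorphism for both ([null_proj_br], [null_proj_lc]).  The Malcev
    identity and flatness descend to [N], which is Euclidean because a vector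
    orthogonal to [e] is spacelike or a multiple of [e].  Reading [M] in the
    coordinates [(<x, e>, projection of x, <x, d>)] gives the double extension,
    with [D u] and [xi u] the projections of [[d, u]] and [u . d], with
    [b0] minus the projection of [d . d], and with [lambda = 0] because
    [[d, e] = 0].  The table of the Levi-Civita product then follows from that
    of the bracket, as it does in any double extension in which [D + xi] is skew
    ([dext_levi_civita]); here [D + xi] is induced by the skew map [L_d]. *)

(** * The Levi-Civita product *)

Section LeviCivita.
Variables (R : realType) (M : pseudoEuclideanMalcev R).
Local Notation B := (mform M).
Local Notation br := (mbr M).
Local Notation lc := (levi_civita (mbr M) (mform M)).
Let ndB := mform_nondegenerate M.
Implicit Types (u v w x y z : M) (a : R).

Lemma mformDl u v w : B (u + v) w = B u w + B v w. Proof. exact: linearDl. Qed.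
Lemma mformDr u v w : B u (v + w) = B u v + B u w. Proof. exact: linearDr. Qed.
Lemma mformBl u v w : B (u - v) w = B u w - B v w. Proof. exact: linearBl. Qed.
Lemma mformBr u v w : B u (v - w) = B u v - B u w. Proof. exact: linearBr. Qed.
Lemma mformNl u v : B (- u) v = - B u v. Proof. exact: linearNl. Qed.
Lemma mformNr u v : B u (- v) = - B u v. Proof. exact: linearNr. Qed.
Lemma mformZl a u v : B (a *: u) v = a * B u v. Proof. exact: linearZl_LR. Qed.
Lemma mformZr a u v : B u (a *: v) = a * B u v.
Proof. exact: (linearZr_LR B u a v). Qed.
Definition mformE :=
  (mformDl, mformDr, mformBl, mformBr, mformNl, mformNr, mformZl, mformZr).

Lemma adjoint_formE (f : 'End(M)) u v : B (adjoint B f u) v = B u (f v).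
Proof.
rewrite form_sym [RHS]form_sym.
exact/esym/((adjointP ndB f _).1 erefl).
Qed.

Lemma mbr_alternate u : br u u = 0.
Proof.
have /eqP := mbr_antisym u u; rewrite -addr_eq0 -mulr2n -scaler_nat.
by rewrite scaler_eq0 pnatr_eq0 => /eqP.
Qed.

Lemma lcE u v w : 2 * B (lc u v) w = B (br u v) w - B (br v w) u + B (br w u) v.
Proof. exact: ((levi_civitaP ndB br u v (lc u v)).1 erefl). Qed.

Lemma lc_unique u v x :
  (forall w, 2 * B x w = B (br u v) w - B (br v w) u + B (br w u) v) ->
  lc u v = x.
Proof. by move=> h; apply/esym/(levi_civitaP ndB). Qed.

Lemma lcPl a u v w : lc (a *: u + v) w = a *: lc u w + lc v w.
Proof.
apply: lc_unique => z; have := lcE u w z; have := lcE v w z.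
rewrite !linearPl !linearPr /= !mformE; nra.
Qed.

Lemma lcPr a u v w : lc w (a *: u + v) = a *: lc w u + lc w v.
Proof.
apply: lc_unique => z; have := lcE w u z; have := lcE w v z.
rewrite !linearPl !linearPr /= !mformE; nra.
Qed.

Lemma lc_torsion u v : lc u v - lc v u = br u v.
Proof.
apply: (nondegenerate_inj ndB) => w; have := lcE u v w; have := lcE v u w.
rewrite mformE (mbr_antisym w u) (mbr_antisym w v) (mbr_antisym v u) !mformE.
lra.
Qed.

Lemma lc_skew u v w : B (lc u v) w = - B v (lc u w).
Proof.
have := lcE u v w; have := lcE u w v.
rewrite (form_sym B v) (mbr_antisym w u) (mbr_antisym w v) (mbr_antisym v u).
rewrite !mformE; lra.
Qed.

End LeviCivita.

(** Declared as bilinear so that the generic lemmas on linear maps apply to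
    both arguments of the product. *)
HB.instance Definition _ (R : realType) (M : pseudoEuclideanMalcev R) :=
  bilinear_isBilinear.Build R M M M *:%R *:%R
    (levi_civita (mbr M) (mform M))
    (conj (fun w a u v => lcPl a u v w) (fun w a u v => lcPr a u v w)).

(** * Isotropic vectors in Lorentzian signature *)

Section Lorentzian.
Variables (R : realType) (M : pseudoEuclideanMalcev R).
Local Notation B := (mform M).
Hypothesis lorM : lorentzian M.

(** The negative vector of an orthogonal basis has this property, which is all
    that the proof uses of the signature. *)
Lemma lorentzian_timelike : exists t : M,
  forall x, B x t = 0 -> x != 0 -> 0 < B x x.
Proof.
have [b [b_basis bB]] := lorM; pose t := tnth b ord0.
have tnE (i : 'I_(1 + (\dim {:M}).-1)) : b`_i = tnth b i.
  by rewrite (tnth_nth 0).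
have xE x : x = \sum_i coord b i x *: tnth b i.
  rewrite [LHS](coord_basis b_basis (memvf x)).
  by apply: eq_bigr => i _; rewrite tnE.
have BxE x i : B x (tnth b i) = coord b i x * B (tnth b i) (tnth b i).
  rewrite {1}(xE x) linear_sumlz (bigD1 i) //= big1 ?addr0 ?mformZl // => j ji.
  by rewrite mformZl bB (negbTE ji) mulr0.
exists t => x xt x0.
have c0 : coord b ord0 x = 0.
  by move: xt; rewrite BxE bB eqxx /= mulrN1 => /eqP; rewrite oppr_eq0 => /eqP.
have BxxE : B x x = \sum_i coord b i x ^+ 2.
  rewrite {2}(xE x) linear_sumr; apply: eq_bigr => i _ /=.
  rewrite mformZr BxE bB eqxx /= expr2; case: ifP; last by rewrite mulr1.
  rewrite ltnS leqn0 => /eqP i0; have -> : i = ord0 by apply: val_inj.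
  by rewrite c0 !mul0r.
have ge0 : forall i, true -> 0 <= coord b i x ^+ 2.
  by move=> i _; exact: sqr_ge0.
rewrite BxxE lt0r sumr_ge0 // andbT; apply: contraNneq x0 => /eqP.
rewrite psumr_eq0 // => /allP h; rewrite (xE x) big1 // => i _.
have /eqP := h i (mem_index_enum _).
by rewrite /= => /eqP; rewrite sqrf_eq0 => /eqP ->; rewrite scale0r.
Qed.

Variable e : M.
Hypotheses (e0 : e != 0) (Bee : B e e = 0).

Lemma timelike_isotropic : exists2 t : M,
  B e t != 0 & forall x, B x t = 0 -> x != 0 -> 0 < B x x.
Proof.
have [t tP] := lorentzian_timelike; exists t => //.
by apply/eqP => et; have := tP e et e0; rewrite Bee ltxx.
Qed.

Lemma isotropic_partner : exists d : M, B d d = 0 /\ B e d = 1.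
Proof.
have [t et tP] := timelike_isotropic.
have [d0 ed0] : exists d0, B e d0 = 1.
  by exists ((B e t)^-1 *: t); rewrite mformZr mulVf.
exists (d0 - (2^-1 * B d0 d0) *: e).
by rewrite !mformE (form_sym B d0 e) ed0 Bee; split; lra.
Qed.

(** Subtracting the multiple of [e] which makes [x] orthogonal to a timelike
    vector does not change [<x, x>], since [e] is isotropic and orthogonal to
    [x]; this avoids the reversed Cauchy-Schwarz inequality. *)
Lemma isotropic_orthogonal_ge0 x : B x e = 0 -> 0 <= B x x.
Proof.
move=> xe; have [t et tP] := timelike_isotropic.
pose y := x - (B x t / B e t) *: e.
have -> : B x x = B y y by rewrite !mformE (form_sym B e x) xe Bee; ring.
have [->|y0] := eqVneq y 0; first by rewrite linear0l.
by apply/ltW/tP => //; rewrite !mformE divfK ?subrr.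
Qed.

Lemma isotropic_orthogonal_eq0 x : B x e = 0 -> B x x = 0 ->
  exists c, x = c *: e.
Proof.
move=> xe xx; have [t et tP] := timelike_isotropic.
exists (B x t / B e t); apply/eqP; rewrite -subr_eq0; apply/negPn/negP => y0.
have := tP _ _ y0; rewrite !mformE (form_sym B e x) xe xx Bee divfK // subrr.
by rewrite !(mulr0, subr0, oppr0) addr0 ltxx => /(_ erefl).
Qed.

(** * A central isotropic vector multiplies by zero *)

Local Notation br := (mbr M).
Local Notation lc := (levi_civita (mbr M) (mform M)).
Hypotheses (flatM : flat M) (ze : forall v, br e v = 0).

Lemma lc_central v : lc v e = lc e v.
Proof. by apply/eqP; rewrite -subr_eq0 lc_torsion mbr_antisym ze oppr0. Qed.

Lemma lc_isotropic_central : lc e e = 0.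
Proof.
apply: lc_unique => w.
by rewrite (mbr_antisym w) !ze oppr0 !linear0l mulr0 subrr addr0.
Qed.

(** The curvature [K(u, v, e)] reduces to [L_v L_u L_e - L_e L_v L_u]; its value
    at [e] vanishes and leaves this triple product, because [e . e = 0] and
    [u . e = e . u]. *)
Lemma lc_central_sandwich u v : lc e (lc v (lc e u)) = 0.
Proof.
have := flatM u v e e; rewrite /curvature.
rewrite (mbr_antisym _ e) ze (mbr_antisym u e) (mbr_antisym v e) !ze !oppr0.
rewrite !linear0l !linear0r !subr0 !add0r lc_isotropic_central !linear0r add0r.
by rewrite lc_central => /eqP; rewrite oppr_eq0 => /eqP.
Qed.

(** In [K(e, v, e)], what remains besides [L_v L_e^2] is [L_e L_v L_e]. *)
Lemma lc_central_sqr v x : lc v (lc e (lc e x)) = 0.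
Proof.
have := flatM e v e x; rewrite /curvature.
rewrite !ze (mbr_antisym v e) ze !oppr0.
by rewrite !linear0l !linear0r !subr0 !add0r lc_central_sandwich subr0.
Qed.

(** [L_e] is skew and [L_v L_e^2 = 0].  Skewness makes [e . (e . x)], and then
    [e . x], isotropic vectors of [e^perp], hence multiples of [e]. *)
Lemma lc_central_eq0 v : lc e v = 0.
Proof.
have Ae x : B (lc e x) e = 0.
  by rewrite lc_skew lc_isotropic_central linear0r oppr0.
have A2 x : lc e (lc e x) = 0.
  have [|c cE] := @isotropic_orthogonal_eq0 (lc e (lc e x)) (Ae _).
    by rewrite lc_skew lc_central_sqr linear0r oppr0.
  have [c0|c0] := eqVneq c 0; first by rewrite cE c0 scale0r.
  (* [c (e . z) = z . (c e) = z . (e . (e . x)) = 0], here with [z = e . x]. *)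
  have : c *: lc e (lc e x) = 0.
    by rewrite -[X in c *: X]lc_central -linearZr_LR /= -cE lc_central_sqr.
  by move/eqP; rewrite scaler_eq0 (negbTE c0) => /eqP.
have Ac x : exists c, lc e x = c *: e.
  by apply: isotropic_orthogonal_eq0; rewrite ?Ae // lc_skew A2 linear0r oppr0.
have Adiag x : B (lc e x) x = 0.
  by have := lc_skew e x x; rewrite (form_sym B x); lra.
have Atransv x : B e x != 0 -> lc e x = 0.
  move=> ex; have [c cE] := Ac x; have := Adiag x; rewrite cE mformZl => /eqP.
  by rewrite mulf_eq0 (negbTE ex) orbF => /eqP ->; rewrite scale0r.
(* For [v] in [e^perp], both [d] and [v + d] lie outside [e^perp]. *)
have [ev|] := eqVneq (B e v) 0; last exact: Atransv.
have [d [_ ed]] := isotropic_partner.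
have d0 : lc e d = 0 by apply: Atransv; rewrite ed oner_neq0.
have := Atransv (v + d); rewrite mformDr ev ed add0r oner_neq0.
by rewrite linearDr /= d0 addr0 => ->.
Qed.

Lemma form_br_central u v : B (br u v) e = 0.
Proof.
have := lcE e u v; rewrite lc_central_eq0 ze (mbr_antisym v e) ze oppr0.
by rewrite !linear0l; lra.
Qed.

End Lorentzian.

(** * The Levi-Civita product of a double extension *)

Section DoubleExtensionLeviCivita.
Variables (R : realType) (N : pseudoEuclideanMalcev R).
Variables (D xi : 'End(N)) (b0 : N) (lam : R).

Lemma dext_form_inj (x y : dext_space N) :
  (forall z, dext_form x z = dext_form y z) -> x = y.
Proof.
case: x y => [[a u] c] [[a' u'] c'] xy; apply: dext_eq => /=.
- by have := xy (0, 0, 1); rewrite /= !linear0r !mulr1 !mulr0 !addr0.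
- apply: (nondegenerate_inj (mform_nondegenerate N)) => w.
  by have := xy (0, w, 0); rewrite /= !mulr0 !add0r.
- by have := xy (1, 0, 0); rewrite /= !linear0r !mulr1 !mulr0 !add0r !addr0.
Qed.

(** The Koszul formula reads
    [2 <d . u, w> = <(D + xi) u, w> - <u, (D + xi) w>], which is
    [2 <(D + xi) u, w>] exactly when [D + xi] is skew.  The same cancellation
    gives [u . d] and the component of [u . v] along [e]. *)
Lemma dext_levi_civita (x y : dext_space N) :
  (forall u v, mform N ((D + xi) u) v = - mform N u ((D + xi) v)) ->
  levi_civita (dext_br D xi b0 lam) (@dext_form R N) x y
    = dext_lc D xi b0 lam x y.
Proof.
move=> skew.
have lcP : is_levi_civita_value (dext_br D xi b0 lam) (@dext_form R N) x y
    (dext_lc D xi b0 lam x y).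
  have skewE s t :
      mform N (D s) t = - mform N s (D t) - mform N s (xi t) - mform N (xi s) t.
    by have := skew s t; rewrite !add_lfunE !mformE; lra.
  case: x y => [[a u] c] [[a' v] c'] [[a'' w] c''].
  rewrite /dext_lc /dext_br /dext_form; have := lcE u v w.
  rewrite !add_lfunE !opp_lfunE !mformE !adjoint_formE.
  (* Both sides become linear in the values of the form once each unordered
     pair of arguments is written in one order only. *)
  rewrite (skewE w u) (skewE w v) (skewE v u).
  rewrite (form_sym _ w (D u)) (form_sym _ w (D v)) (form_sym _ v (D u)).
  rewrite (form_sym _ w (xi u)) (form_sym _ w (xi v)) (form_sym _ u (xi v)).
  rewrite (form_sym _ v (xi u)) (form_sym _ v (xi w)).
  lra.
apply: xget_unique => // z zP; apply: dext_form_inj => w.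
by apply: (@mulfI _ 2); rewrite ?pnatr_eq0 // zP lcP.
Qed.

End DoubleExtensionLeviCivita.

(** * Reduction along a central isotropic line *)

Section NullPlane.
Variables (R : realType) (M : pseudoEuclideanMalcev R) (e d : M).
Local Notation B := (mform M).
Local Notation br := (mbr M).

(** The orthogonal of the hyperbolic plane of [e] and [d], a model of
    [e^perp / <e>] inside [M]. *)
Definition null_perp : {vspace M} :=
  (orthov B <[d]> :&: orthov B <[e]>)%VS.

Definition null_residue (x : M) : M := x - B x e *: d - B x d *: e.

Fact null_residue_linear : linear null_residue.
Proof.
move=> a x y; rewrite /null_residue !mformE !scalerDl !scalerBr -!scalerA.
by rewrite !opprD (addrACA (a *: x) y) (addrACA (a *: x - _)).
Qed.

HB.instance Definition _ :=
  GRing.isLinear.Build R M M *:%R null_residue null_residue_linear.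

Definition null_proj (x : M) : subvs_of null_perp :=
  vsproj null_perp (null_residue x).

Fact null_proj_linear : linear null_proj.
Proof. by move=> a x y; rewrite /null_proj !linearP. Qed.

HB.instance Definition _ :=
  GRing.isLinear.Build R M (subvs_of null_perp) *:%R null_proj null_proj_linear.

Definition null_form (u v : subvs_of null_perp) : R := B (vsval u) (vsval v).

Fact null_form_bilinear : bilinear_for *%R (idfun \; *%R) null_form.
Proof.
by split=> w a u v; rewrite /null_form /= !mformE.
Qed.

HB.instance Definition _ := bilinear_isBilinear.Build R
  (subvs_of null_perp) (subvs_of null_perp) R *%R (idfun \; *%R)
  null_form null_form_bilinear.

Fact null_form_sym u v : null_form u v = (-1) ^+ false * null_form v u.
Proof. by rewrite expr0 mul1r /null_form form_sym. Qed.

HB.instance Definition _ := isHermitianSesquilinear.Build R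
  (subvs_of null_perp) false idfun null_form null_form_sym.

Definition null_br (u v : subvs_of null_perp) : subvs_of null_perp :=
  null_proj (br (vsval u) (vsval v)).

Fact null_br_bilinear : bilinear_for *:%R *:%R null_br.
Proof.
by split=> w a u v; rewrite /null_br /= ?linearPl ?linearPr linearP.
Qed.

HB.instance Definition _ := bilinear_isBilinear.Build R
  (subvs_of null_perp) (subvs_of null_perp) (subvs_of null_perp) *:%R *:%R
  null_br null_br_bilinear.

Hypotheses (Bee : B e e = 0) (Bdd : B d d = 0) (Bed : B e d = 1).

Lemma null_perp_e (u : subvs_of null_perp) : B (vsval u) e = 0.
Proof.
have := subvsP u; rewrite memv_cap => /andP[_].
by rewrite mem_orthov1 => /eqP.
Qed.

Lemma null_perp_d (u : subvs_of null_perp) : B (vsval u) d = 0.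
Proof.
have := subvsP u; rewrite memv_cap => /andP[+ _].
by rewrite mem_orthov1 => /eqP.
Qed.

Lemma val_null_proj x :
  vsval (null_proj x) = x - B x e *: d - B x d *: e.
Proof.
rewrite vsprojK // memv_cap !mem_orthov1 /null_residue.
rewrite !mformE Bee Bdd (form_sym B d) Bed.
by apply/andP; split; apply/eqP; ring.
Qed.

Lemma null_decomp x : x = B x e *: d + vsval (null_proj x) + B x d *: e.
Proof. by rewrite val_null_proj -addrA subrK addrC subrK. Qed.

Lemma null_projK u : null_proj (vsval u) = u.
Proof.
apply: subvs_inj.
by rewrite val_null_proj null_perp_e null_perp_d !scale0r !subr0.
Qed.

Lemma null_proj_e : null_proj e = 0.
Proof.
by apply: subvs_inj; rewrite val_null_proj Bee Bed scale0r scale1r subr0 subrr.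
Qed.

Lemma null_proj_d : null_proj d = 0.
Proof.
apply: subvs_inj; rewrite val_null_proj Bdd (form_sym B) Bed.
by rewrite scale0r scale1r subr0 subrr.
Qed.

Lemma form_null_proj x (u : subvs_of null_perp) :
  B (vsval (null_proj x)) (vsval u) = B x (vsval u).
Proof.
rewrite val_null_proj !mformE (form_sym B d) (form_sym B e).
by rewrite null_perp_e null_perp_d; ring.
Qed.

(** The projection is self-adjoint, so pairing with [N] detects the whole of a
    vector of [N]. *)
Lemma null_form_nondegenerate : nondegenerate null_form.
Proof.
apply/eqP/vspaceP => u; rewrite memv0.
apply/mem_orthovP/eqP => [h|->]; last first.
  by move=> v _; rewrite linear0l.
apply: subvs_inj; apply: (nondegenerate_eq0 (mform_nondegenerate M)) => w.
rewrite (form_sym B) -form_null_proj (form_sym B).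
exact: (h (null_proj w) (memvf _)).
Qed.

Hypotheses (ze : forall v, br e v = 0) (bre : forall u v, B (br u v) e = 0).

(** A vector of [e^perp] differs from its projection by a multiple of the
    central vector [e]. *)
Lemma null_proj_br x y : B x e = 0 -> B y e = 0 ->
  null_proj (br x y) = null_br (null_proj x) (null_proj y).
Proof.
move=> xe ye; rewrite {1}(null_decomp x) {1}(null_decomp y) xe ye !scale0r.
rewrite !add0r !(linearDl, linearDr, linearZl_LR, linearZr_LR) /= !ze.
by rewrite (mbr_antisym _ e) ze oppr0 !scaler0 !addr0.
Qed.

Lemma null_br_antisym u v : null_br u v = - null_br v u.
Proof. by rewrite /null_br mbr_antisym linearN. Qed.

(** Every bracket lies in [e^perp], so the identity in [M] projects to [N]. *)
Lemma null_br_malcev u v w :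
  jacobiator null_br u v (null_br u w) = null_br (jacobiator null_br u v w) u.
Proof.
have jacE x y z : B x e = 0 -> B y e = 0 -> B z e = 0 ->
    jacobiator null_br (null_proj x) (null_proj y) (null_proj z)
      = null_proj (jacobiator br x y z).
  by move=> xe ye ze'; rewrite /jacobiator !linearD /= !null_proj_br.
rewrite -(null_projK u) -(null_projK v) -(null_projK w).
rewrite -null_proj_br ?null_perp_e // !jacE ?null_perp_e // mbr_malcev.
by rewrite null_proj_br ?null_perp_e // /jacobiator !mformE !bre !addr0.
Qed.

Definition null_reduction : pseudoEuclideanMalcev R :=
  @PseudoEuclideanMalcev R (subvs_of null_perp) null_br null_form
    null_br_antisym null_br_malcev null_form_nondegenerate.

Local Notation N := null_reduction.
Local Notation lc := (levi_civita br B).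

Lemma br_null_vector v : br v e = 0.
Proof. by rewrite mbr_antisym ze oppr0. Qed.

Lemma lc_null_vector v : lc e v = 0.
Proof.
apply: lc_unique => w.
by rewrite (mbr_antisym w) !ze oppr0 !linear0l bre mulr0 subrr addr0.
Qed.

Lemma lc_null_vector_r v : lc v e = 0.
Proof. by rewrite lc_central // lc_null_vector. Qed.

Lemma form_lc_null x y : B (lc x y) e = 0.
Proof. by rewrite lc_skew lc_null_vector_r linear0r oppr0. Qed.

(** The projection satisfies the Koszul formula of [N], since it does not affect
    the pairing with vectors of [N]. *)
Lemma null_lcE (u v : N) :
  levi_civita (mbr N) (mform N) u v = null_proj (lc (vsval u) (vsval v)).
Proof.
apply: lc_unique => w /=.
by rewrite /null_form !form_null_proj lcE.
Qed.

Lemma null_proj_lc x y : B x e = 0 -> B y e = 0 ->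
  null_proj (lc x y)
    = levi_civita (mbr N) (mform N) (null_proj x : N) (null_proj y : N).
Proof.
move=> xe ye; rewrite null_lcE {1}(null_decomp x) {1}(null_decomp y) xe ye.
rewrite !scale0r !add0r !(linearDl, linearDr, linearZl_LR, linearZr_LR) /=.
by rewrite !lc_null_vector !lc_null_vector_r !scaler0 !addr0.
Qed.

Lemma null_reduction_flat : flat M -> flat N.
Proof.
move=> flatM u v w x.
rewrite -(null_projK u) -(null_projK v) -(null_projK w) -(null_projK x).
have := congr1 null_proj (flatM (vsval u) (vsval v) (vsval w) (vsval x)).
rewrite /curvature linear0 => <-.
rewrite !(linearB, linearD) /= -!null_proj_br ?null_perp_e //.
by rewrite -!null_proj_lc ?null_perp_e ?form_lc_null.
Qed.

Lemma null_reduction_euclidean :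
  e != 0 -> lorentzian M -> euclidean N.
Proof.
move=> e0 lorM u u0; rewrite lt0r.
rewrite (isotropic_orthogonal_ge0 lorM e0 Bee) ?null_perp_e // andbT.
apply: contra_neq u0 => uu.
have [c cE] := isotropic_orthogonal_eq0 lorM e0 Bee (null_perp_e u) uu.
by rewrite -(null_projK u) cE linearZ /= null_proj_e scaler0.
Qed.

(** * The isometry with a double extension *)

Definition null_D : 'End(N) := linfun (null_proj \o br d \o vsval).
Definition null_xi : 'End(N) := linfun (null_proj \o applyr lc d \o vsval).
Definition null_b0 : N := - null_proj (lc d d).

Lemma null_DE u : null_D u = null_proj (br d (vsval u)).
Proof. by rewrite lfunE. Qed.

Lemma null_xiE u : null_xi u = null_proj (lc (vsval u) d).
Proof. by rewrite lfunE. Qed.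

(** [[d, u] + u . d = d . u], so [D + xi] is the skew map [L_d] followed by the
    self-adjoint projection. *)
Lemma null_D_xi_skew (u v : N) :
  mform N ((null_D + null_xi) u) v = - mform N u ((null_D + null_xi) v).
Proof.
have sumE w : (null_D + null_xi) w = null_proj (lc d (vsval w)).
  by rewrite add_lfunE null_DE null_xiE -linearD /= -lc_torsion subrK.
rewrite !sumE /= /null_form form_null_proj (form_sym B (vsval u)).
by rewrite form_null_proj lc_skew form_sym.
Qed.

Lemma null_b0E (u : N) : mform N null_b0 u = B (br d (vsval u)) d.
Proof.
rewrite /= /null_form /null_b0 linearN /= mformNl form_null_proj.
have := lcE d d (vsval u).
rewrite (mbr_antisym (vsval u) d) mbr_alternate mformNl linear0l; lra.
Qed.

Lemma null_xi_antisym (u v : N) :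
  - mform N ((null_xi - adjoint (mform N) null_xi) u) v
    = B (br (vsval u) (vsval v)) d.
Proof.
rewrite add_lfunE opp_lfunE !mformE adjoint_formE (form_sym _ u) !null_xiE.
rewrite /= /null_form !form_null_proj -lc_torsion mformBl.
rewrite !(lc_skew _ d) opprB opprK.
by rewrite !(form_sym B d) addrC.
Qed.

Definition null_coord (x : M) : dext_space N := (B x e, null_proj x, B x d).

Fact null_coord_linear : linear null_coord.
Proof.
move=> a x y; apply: (@dext_eq R N); rewrite /= ?mformE //.
by rewrite linearP.
Qed.

HB.instance Definition _ :=
  GRing.isLinear.Build R M (dext_space N) *:%R null_coord null_coord_linear.

Lemma null_coord_bij : bijective null_coord.
Proof.
exists (fun y => y.1.1 *: d + vsval y.1.2 + y.2 *: e) => [x|[[a u] c]] /=.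
  by rewrite -null_decomp.
apply: (@dext_eq R N) => /=.
- by rewrite !mformE Bee (form_sym B d) Bed null_perp_e; ring.
- rewrite !linearD !linearZ /= null_proj_e null_proj_d null_projK.
  by rewrite !scaler0 add0r addr0.
- by rewrite !mformE Bdd Bed null_perp_d; ring.
Qed.

Lemma null_coord_form x y :
  dext_form (null_coord x) (null_coord y) = B x y.
Proof.
rewrite /= /null_form [in RHS](null_decomp x) [in RHS](null_decomp y) !mformE.
rewrite !(form_sym B d (vsval _)) !(form_sym B e (vsval _)).
rewrite !null_perp_e !null_perp_d (form_sym B d e) Bee Bdd Bed.
by ring.
Qed.

(** There is no component along [d] because [<[x, y], e> = 0]; the component
    along [e] is [<[x, y], d>], which [null_b0E] and [null_xi_antisym] express
    through [b0] and [xi]. *)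
Lemma null_coord_br x y :
  null_coord (br x y)
    = dext_br null_D null_xi null_b0 0 (null_coord x) (null_coord y).
Proof.
have brE : br x y = B x e *: br d (vsval (null_proj y))
    - B y e *: br d (vsval (null_proj x))
    + br (vsval (null_proj x)) (vsval (null_proj y)).
  rewrite {1}(null_decomp x) {1}(null_decomp y).
  rewrite !(linearDl, linearDr, linearZl_LR, linearZr_LR) /=.
  rewrite !ze !br_null_vector mbr_alternate (mbr_antisym _ d) !scaler0.
  by rewrite !(addr0, add0r) scalerN addrA.
apply: (@dext_eq R N) => /=.
- exact: bre.
- by rewrite brE linearD linearB !null_DE !linearZ_LR.
- rewrite brE !mformE -!null_b0E -null_xi_antisym /=.
  by rewrite mul0r add0r.
Qed.

End NullPlane.

Theorem theorem4p3 (R : realType) (M : pseudoEuclideanMalcev R)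
    (flatM : flat M) (lorM : lorentzian M) (degM : degenerate_center M) :
  exists (N : pseudoEuclideanMalcev R) (D xi : 'End(N)) (b0 : N),
    [/\ flat N, euclidean N & flat_double_extension M D xi b0 0].
Proof.
have [e [ze perp_e] e0] : exists2 e : M,
    center (mbr M) e /\ orthogonal_set (mform M) (center (mbr M)) e & e != 0.
  apply: contrapT => none; apply: degM; apply/seteqP.
  split=> [x [zx px]|x ->] /=.
    by apply: contrapT => /eqP x0; apply: none; exists x.
  by split=> v; rewrite linear0l.
have Bee : mform M e e = 0 by exact: perp_e.
have [d [Bdd Bed]] := isotropic_partner lorM e0 Bee.
have bre := form_br_central lorM e0 Bee flatM ze.
exists (null_reduction Bee Bdd Bed ze bre), (null_D Bee Bdd Bed ze bre),
  (null_xi Bee Bdd Bed ze bre), (null_b0 Bee Bdd Bed ze bre).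
have flatN : flat (null_reduction Bee Bdd Bed ze bre).
  exact: null_reduction_flat.
split=> //; first exact: null_reduction_euclidean.
split=> // [x y|]; first exact/dext_levi_civita/null_D_xi_skew.
exists (linfun (null_coord Bee Bdd Bed ze bre)); split.
- have [g fK gK] := null_coord_bij Bee Bdd Bed ze bre.
  by exists g => x; rewrite lfunE /=; [apply: fK | apply: gK].
- by move=> u v; rewrite !lfunE; exact: null_coord_br.
- by move=> u v; rewrite !lfunE; exact: null_coord_form.
Qed.
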